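(* Let $G$ be a $4$-edge-connected graph. Then $G$ has a spanning Eulerian subgraph $H$ such that for each vertex $v$, $$\left\lfloor \frac{d_{G}(v)}{2}\right\rfloor-1\le d_H(v)\le \left\lceil \frac{d_{G}(v)}{2}\right\rceil+2.$$
   Context: Graphs may have loops and multiple edges. $d_G(v)$ denotes the degree of $v$ in $G$. A spanning Eulerian subgraph of $G$ is a connected spanning subgraph of $G$ all of whose vertex degrees are even. *)

(* Defs.v *)
From mathcomp Require Import all_boot.

Set Implicit Arguments.
Unset Strict Implicit.
Unset Printing Implicit Defensive.

(* Finite graphs with loops and multiple edges.  The pair of ends of an edge is
   ordered only as a matter of representation: no notion below depends on the
   order. *)
Record multigraph := Multigraph {
  vertex : finType;
  edge : finType;
  ends : edge -> vertex * vertex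
}.

Section Multigraph.
Variable G : multigraph.

(* A spanning subgraph of G keeps all the vertices, so it is given by its set
   F of edges; G itself is the case F = [set: edge G]. *)
Implicit Types (F : {set edge G}) (u v : vertex G).

(* A loop contributes 2 to the degree of its vertex. *)
Definition degree F v : nat :=
  \sum_(e in F) (((ends e).1 == v) + ((ends e).2 == v)).

Definition adjacent F : rel (vertex G) :=
  [rel u v | [exists e in F, (ends e == (u, v)) || (ends e == (v, u))]].

Definition connected F : Prop := forall u v, connect (adjacent F) u v.

Definition spanning_eulerian F : Prop :=
  connected F /\ forall v, ~~ odd (degree F v).

Definition edge_connected (k : nat) : Prop :=
  forall F, #|F| < k -> connected (~: F).

End Multigraph.

(* Main.v *)
Require Import Defs.
From mathcomp Require Import all_boot all_fingroup all_algebra zify.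

Set Implicit Arguments.
Unset Strict Implicit.
Unset Printing Implicit Defensive.

(* Fix a root r.  A rounding argument followed by path reversals orients G so
   that in- and out-degrees differ by at most 1 at every vertex and every
   nonempty vertex set avoiding r is entered by two edges; hence (Edmonds) there
   is a spanning out-arborescence T from r whose removal still leaves an edge
   entering each such set.  Dummy arcs from the vertices of in-excess to those of
   out-excess make the digraph Eulerian, so that each arc a into v can be paired
   with an arc t a out of v.

   If membership in H alternated along all these pairs, H would use exactly half
   of the edge ends at each vertex.  Let e v be the arc of T into v (any arc into
   r if v = r), and demand that e v be in H and dummies be outside H.  Let the
   alternation fail only at e v, at the dummy entering v, and at one further arc
   g v entering v; this costs at most what the theorem allows.  That these defects
   suffice to make H even is an F_2-linear problem on the arcs, solvable as soon
   as a certain graph on the arcs is connected, and a pairing t maximizing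
   reachability in the digraph [step] makes it so. *)

(** * Preliminaries on counting and shortest walks *)

Lemma cards_sum1 (T : finType) (Q : pred T) : #|[set x | Q x]| = \sum_x Q x.
Proof. by rewrite -sum1dep_card big_mkcond /=; apply: eq_bigr => x _; case: (Q x). Qed.

Lemma exists_enumeration (V : finType) (B : {set V}) n : #|B| = n ->
  exists f : 'I_n -> V, forall v, #|[set i | f i == v]| = (v \in B).
Proof.
move=> <-; exists (fun i => enum_val i) => v.
rewrite cards_sum1 -(big_enum_val (fun x => nat_of_bool (x == v))) /=.
case: (boolP (v \in B)) => vB; last first.
  by rewrite big1 // => x xB; apply/eqP; rewrite eqb0; apply: contraNneq vB => <-.
by rewrite (bigD1 v) //= eqxx big1 // => x /andP[_ /negPf->].
Qed.

(** [rk] is the distance to [x], and [next a] a successor of [a] closer to [x]. *)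
Lemma exists_rank (T : finType) (s : rel T) (x : T) : (forall a, connect s a x) ->
  exists (next : T -> T) (rk : T -> nat),
    forall a, a != x -> s a (next a) /\ rk (next a) < rk a.
Proof.
move=> con; pose walk a n := [exists p : n.-tuple T, path s a p && (x == last a p)].
have ex a : exists n, walk a n.
  have /connectP[p pa lp] := con a; exists (size p); apply/existsP.
  by exists (in_tuple p); rewrite pa -lp eqxx.
pose rk a := ex_minn (ex a).
have ex_next a : a != x -> exists b, s a b && (rk b < rk a).
  move=> ax; rewrite {2}/rk; case: ex_minnP => n /existsP[p /andP[]].
  case: n p => [|n] p; first by rewrite tuple0 => _ /eqP xa; rewrite xa eqxx in ax.
  case/tupleP: p => b p /= /andP[ab pb] lp _; exists b; rewrite ab /= ltnS /rk.
  by case: ex_minnP => k _; apply; apply/existsP; exists p; rewrite pb.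
exists (fun a => odflt a [pick b | s a b && (rk b < rk a)]), rk => a /ex_next[b ab].
by case: pickP => [c /andP[]|/(_ b)]; rewrite ?ab.
Qed.

(** * Balanced orientations *)

(* Round off two elements v, u of O at a time, lowering v and raising u.  A
   tight set W containing v has even intersection with O, so the smallest one
   contains a second u in O; it lies in all the tight sets containing v. *)
Lemma balanced_rounding (V : finType) (b : {set V} -> int) (O : {set V}) :
    (forall X Y, X :&: Y != set0 -> (b (X :&: Y) + b (X :|: Y) <= b X + b Y)%R) ->
    (forall X : {set V}, X != set0 -> (0 <= b X)%R) -> b setT = 0%R ->
    (forall X, exists k : int, b X = (k * 2 + Posz #|X :&: O|)%R) ->
  exists B : {set V}, [/\ B \subset O, #|B| = #|O :\: B| &
    forall X : {set V}, X != set0 -> (Posz #|X :&: (O :\: B)| <= b X + Posz #|X :&: B|)%R].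
Proof.
have [n] := ubnP #|O|; elim: n b O => // n IHn b O leOn bsub b_ge0 bT bpar.
have [->|[v vO]] := set_0Vmem O.
  exists set0; split; rewrite ?sub0set ?set0D //.
  by move=> X /b_ge0; rewrite !setI0 cards0; lia.
pose tight (X : {set V}) := (v \in X) && (b X == 0%R).
have tightT : tight setT by rewrite /tight inE bT eqxx.
case: (@arg_minnP _ setT tight (fun X => #|X|) tightT) => W /andP[vW /eqP bW] Wmin.
have [u /andP[uv uO] uW] : exists2 u, (u != v) && (u \in O) & u \in W.
  have [k] := bpar W; rewrite bW (cardsD1 v) inE vW vO /= => e.
  have /card_gt0P[u] : 0 < #|(W :&: O) :\ v| by lia.
  by rewrite !inE => /and3P[? ? ?]; exists u => //; apply/andP.
have uT (X : {set V}) : v \in X -> b X = 0%R -> u \in X.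
  move=> vX bX; have vI : v \in W :&: X by rewrite inE vW.
  have nI : W :&: X != set0 by apply/set0Pn; exists v.
  have nU : W :|: X != set0 by apply/set0Pn; exists v; rewrite inE vW.
  (* Submodularity squeezes [b (W :&: X)] to 0, so [W :&: X] is tight and, [W] being smallest,
     equals [W]. *)
  have := bsub W X nI; have := b_ge0 _ nI; have := b_ge0 _ nU.
  rewrite bW bX => ? ? ?; have /Wmin : tight (W :&: X).
    by rewrite /tight vI; apply/eqP; lia.
  move=> le; have /eqP eW : W :&: X == W by rewrite eqEcard subsetIl.
  by move: uW; rewrite -{1}eW => /setIP[].
(* Putting [u] in [B] and [v] in [O :\: B] changes the required inequality by exactly these two
   terms. *)
pose b1 (X : {set V}) : int := (b X + Posz (u \in X) - Posz (v \in X))%R.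
pose O1 := O :\ v :\ u.
have cO (X : {set V}) : #|X :&: O| = (u \in X) + (v \in X) + #|X :&: O1|.
  rewrite (cardsD1 v (X :&: O)) (cardsD1 u) !inE uv uO vO !andbT /= addnCA addnA.
  by congr (_ + _); apply: eq_card => z; rewrite !inE; do !case: (_ \in _); do !case: eqP.
case: (IHn b1 O1).
- by have := cO setT; rewrite !setTI !inE; lia.
- by move=> X Y /bsub; rewrite /b1 !inE; do 4! case: (_ \in _) => /=; clear; lia.
- move=> X nX; have := b_ge0 _ nX; rewrite /b1; case: (boolP (v \in X)) => vX; last lia.
  by move=> ?; case: (eqVneq (b X) 0%R) => [/(uT _ vX) ->|]; lia.
- by rewrite /b1 !inE bT.
- move=> X; have [k ek] := bpar X; have := cO X; rewrite /b1 ek => ->.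
  by exists (k + Posz (u \in X))%R; lia.
move=> B1 [sB1 cB1 hB1].
have uB1 : u \notin B1 by apply/negP => /(subsetP sB1); rewrite !inE eqxx.
have vB1 : v \notin B1 by apply/negP => /(subsetP sB1); rewrite !inE eqxx andbF.
exists (u |: B1).
have cB (X : {set V}) : #|X :&: (u |: B1)| = (u \in X) + #|X :&: B1|.
  rewrite (cardsD1 u) !inE eqxx andbT; congr (_ + _).
  by apply: eq_card => z; rewrite !inE; case: eqP => [->|]; rewrite ?(negPf uB1) ?andbF.
have cD (X : {set V}) : #|X :&: (O :\: (u |: B1))| = (v \in X) + #|X :&: (O1 :\: B1)|.
  rewrite (cardsD1 v) !inE vO eq_sym (negPf uv) (negPf vB1) !andbT; congr (_ + _).
  by apply: eq_card => z; rewrite !inE; do !case: (_ \in _); do !case: eqP.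
split.
- apply/subsetP=> z /setU1P[->//|/(subsetP sB1)]; rewrite !inE; by case/and3P.
- by have := cB setT; have := cD setT; rewrite !setTI !inE cB1 => -> ->.
- by move=> X nX; have := hB1 X nX; rewrite cB cD /b1; clear; lia.
Qed.

Section Orientation.

Variables (V E : finType) (ends : E -> V * V).

(** An orientation is the set [o] of edges kept in their stored direction, so that orientations form
    a finite type. *)
Definition arc_head (o : {set E}) a := if a \in o then (ends a).2 else (ends a).1.
Definition arc_tail (o : {set E}) a := if a \in o then (ends a).1 else (ends a).2.
Definition indeg (o : {set E}) v := #|[set a | arc_head o a == v]|.
Definition inner (W : {set V}) := [set a | ((ends a).1 \in W) && ((ends a).2 \in W)].

Lemma head_tail_in o a (W : {set V}) :
  ((ends a).1 \in W) && ((ends a).2 \in W) = (arc_head o a \in W) && (arc_tail o a \in W).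
Proof. by rewrite /arc_head /arc_tail; case: ifP => // _; rewrite andbC. Qed.

Lemma sum_indeg o (W : {set V}) : \sum_(v in W) indeg o v = #|[set a | arc_head o a \in W]|.
Proof.
rewrite cards_sum1; under eq_bigr do rewrite /indeg cards_sum1.
rewrite exchange_big /=; apply: eq_bigr => a _.
have [hW|hW] := boolP (arc_head o a \in W).
  rewrite (bigD1 _ hW) /= eqxx big1 ?addn0 // => v /andP[_].
  by rewrite eq_sym => /negPf->.
by rewrite big1 // => v vW; apply/eqP; rewrite eqb0; apply: contraNneq hW => ->.
Qed.

Definition flip (o : {set E}) a := if a \in o then o :\ a else a |: o.

Lemma head_flip o a b : arc_head (flip o a) b = if b == a then arc_tail o a else arc_head o b.
Proof.
rewrite /arc_head /arc_tail /flip; case: (boolP (a \in o)) => ao; rewrite !inE.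
  by case: eqVneq => [->|].
by case: eqVneq => [->|].
Qed.

Lemma tail_flip o a b : b != a -> arc_tail (flip o a) b = arc_tail o b.
Proof. by rewrite /arc_tail /flip => ba; case: (a \in o); rewrite !inE ?ba ?(negPf ba). Qed.

Lemma indeg_flip o a v :
  indeg (flip o a) v + (arc_head o a == v) = indeg o v + (arc_tail o a == v).
Proof.
rewrite /indeg !cards_sum1 (bigD1 a) //= [in RHS](bigD1 a) //= head_flip eqxx.
set x := \sum_(_ | _) _; set y := \sum_(_ | _) _.
have -> : x = y by apply: eq_bigr => b /negPf ba; rewrite head_flip ba.
by lia.
Qed.

Definition arc_rel (o : {set E}) : rel V :=
  fun u v => [exists a, (arc_tail o a == u) && (arc_head o a == v)].

(** Reversing the path would move one unit of in-degree from its end to [v]. The induction looks at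
    the last arc, from [w] to [u]: if [w] is deficient, reversing this arc already helps; if [w] is
    exact, reversing it passes the excess on to [w]; if [w] has excess, the shorter path serves as
    it is. *)
Lemma orientation_improve (m : V -> nat) o v p :
  path (arc_rel o) v p -> uniq (v :: p) -> indeg o v < m v -> m (last v p) < indeg o (last v p) ->
  exists o', \sum_u (m u - indeg o' u) < \sum_u (m u - indeg o u).
Proof.
elim/last_ind: p o => [|p u IHp] o; first by rewrite /=; lia.
rewrite rcons_path last_rcons -rcons_cons rcons_uniq.
move=> /andP[pv /existsP[a /andP[/eqP ta /eqP ha]]].
set w := last v p in ta *; case/andP => uvp vp mv mu.
have wu : w != u by apply: contraNneq uvp => <-; exact: mem_last.
have deg x := indeg_flip o a x; rewrite ha ta in deg.
have degu := deg u; rewrite eqxx (negPf wu) in degu.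
have degw := deg w; rewrite eqxx eq_sym (negPf wu) in degw.
have degx x : x != u -> x != w -> indeg (flip o a) x = indeg o x.
  by move=> /negPf xu /negPf xw; have := deg x; rewrite !(eq_sym _ x) xu xw; lia.
have sumD o1 : \sum_x (m x - indeg o1 x) =
    (m u - indeg o1 u) + (m w - indeg o1 w) + \sum_(x | (x != u) && (x != w)) (m x - indeg o1 x).
  by rewrite (bigD1 u) //= (bigD1 w) //= addnA.
have same : \sum_(x | (x != u) && (x != w)) (m x - indeg (flip o a) x) =
    \sum_(x | (x != u) && (x != w)) (m x - indeg o x).
  by apply: eq_bigr => x /andP[xu xw]; rewrite degx.
have [lt_wm|] := ltnP (indeg o w) (m w).
  by exists (flip o a); rewrite !sumD same; lia.
rewrite leq_eqVlt => /predU1P[eq_wm|]; last exact: IHp.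
case: (IHp (flip o a)) => //.
- move: pv; apply: (@sub_in_path _ (mem (v :: p))); last exact/allP.
  move=> x y _ yp /existsP[b /andP[/eqP tb /eqP hb]]; apply/existsP; exists b.
  have ba : b != a by apply: contraNneq uvp => eba; rewrite -ha -eba hb.
  by rewrite tail_flip // head_flip (negPf ba) tb hb !eqxx.
- rewrite degx //; first by apply: contraNneq uvp => <-; rewrite mem_head.
  by apply: contraTneq mv => ->; rewrite eq_wm ltnn.
- by rewrite -/w; lia.
- by move=> o' lt; exists o'; rewrite (leq_trans lt) // !sumD same; lia.
Qed.

(** Hakimi's theorem. Let [v] be deficient in an orientation of least total deficiency. No arc
    leaves the set [R] reachable from [v], so the vertices outside [R] receive only arcs inside
    [~: R]. The hypothesis on [~: R] then forces a vertex of excess in [R], and a path to it allows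
    an improvement. *)
Lemma exists_orientation (m : V -> nat) :
  \sum_v m v = #|E| -> (forall W : {set V}, #|inner W| <= \sum_(v in W) m v) ->
  exists o, forall v, indeg o v = m v.
Proof.
move=> mT mW; pose def (o : {set E}) := \sum_u (m u - indeg o u).
case: (@arg_minnP _ set0 predT def isT) => o _ omin.
have sumT : \sum_v indeg o v = #|E|.
  have := sum_indeg o setT; rewrite -cardsT => /=.
  have -> : [set a | arc_head o a \in [set: V]] = [set: E] by apply/setP=> a; rewrite !inE.
  by move=> <-; apply: eq_bigl => v; rewrite inE.
suff le_m v : m v <= indeg o v.
  exists o => v; apply/eqP; rewrite eq_sym.
  have [_] := leqif_sum (fun u (_ : xpredT u) => leqif_eq (le_m u)).
  by rewrite mT sumT eqxx => /esym/forallP/(_ v).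
rewrite leqNgt; apply/negP => mv; pose R := [set u | connect (arc_rel o) v u].
have vR : v \in R by rewrite inE connect0.
have [u uR mu] : exists2 u, u \in R & m u < indeg o u.
  apply/exists_inP; apply: contraTT mv; rewrite negb_exists_in -leqNgt => /forall_inP le.
  have sumC (F : V -> nat) : \sum_x F x = \sum_(x in R) F x + \sum_(x in ~: R) F x.
    rewrite (bigID (mem R)) /=; congr (_ + _); by apply: eq_bigl => x; rewrite in_setC.
  have inR : \sum_(x in ~: R) indeg o x = #|inner (~: R)|.
    rewrite sum_indeg; apply: eq_card => a; rewrite inE [RHS]inE (head_tail_in o).
    case: (boolP (arc_head o a \in ~: R)) => //= hR.
    apply/esym; move: hR; rewrite !inE; apply: contra.
    move=> vt; apply: connect_trans vt (connect1 _); apply/existsP; exists a; by rewrite !eqxx.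
  have Rm := sumC m; have Ri := sumC (indeg o); have Rw := mW (~: R).
  rewrite mT (bigD1 v) //= in Rm; rewrite sumT inR (bigD1 v) //= in Ri.
  have : \sum_(x in R | x != v) indeg o x <= \sum_(x in R | x != v) m x.
    by apply: leq_sum => x /andP[xR _]; rewrite leqNgt le.
  by clear -Rm Ri Rw; lia.
move: uR; rewrite inE => /connectP[p pv lst]; move: mu; rewrite lst.
case: (shortenP pv) => q qv uq _ mu.
have [o'] := orientation_improve qv uq mv mu.
by rewrite ltnNge => /negP; case; exact: omin.
Qed.

End Orientation.

(** * Disjoint branchings *)

Section Branching.

Variables (V E : finType) (hd tl : E -> V) (r : V).

Definition entering (T : {set E}) (W : {set V}) :=
  [set a | [&& a \notin T, hd a \in W & tl a \notin W]].

Lemma entering_submod T (X Y : {set V}) :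
  #|entering T (X :&: Y)| + #|entering T (X :|: Y)| <= #|entering T X| + #|entering T Y|.
Proof.
rewrite /entering !cards_sum1 -!big_split /=; apply: leq_sum => a _; rewrite !inE.
by case: (a \in T); do 4!case: (_ \in _).
Qed.

Definition arc_in (T : {set E}) : rel V :=
  fun u v => [exists a in T, (tl a == u) && (hd a == v)].

(* Lovasz's proof of the case of two branchings of Edmonds' theorem. *)
Lemma packed_branching :
  (forall W, W != set0 -> r \notin W -> 1 < #|entering set0 W|) ->
  exists T : {set E}, [/\ {in T &, injective hd}, forall a, a \in T -> hd a != r,
    forall v, connect (arc_in T) r v &
    forall W, W != set0 -> r \notin W -> 0 < #|entering T W|].
Proof.
move=> ent2.
have tight1 i u x : 0 < i -> 0 < u -> i + u <= 1 + x -> x <= 1 -> i = 1 by lia.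
pose dom (T : {set E}) := r |: [set hd a | a in T].
pose good (T : {set E}) := [&& [forall a in T, forall b in T, (hd a == hd b) ==> (a == b)],
  [forall a in T, hd a != r],
  [forall v in dom T, connect (arc_in T) r v] &
  [forall W : {set V}, (W != set0) && (r \notin W) ==> (0 < #|entering T W|)]].
have good0 : good set0.
  apply/and4P; split; try by apply/forall_inP=> a; rewrite inE.
    apply/forall_inP=> v; rewrite /dom imset0 setU0 => /set1P->; exact: connect0.
  by apply/forallP=> W; apply/implyP=> /andP[nW rW]; apply: ltn_trans (ent2 _ nW rW).
case: (@arg_maxnP _ set0 good (fun T => #|T|) good0) => T /and4P[injT nrT conT entT] Tmax.
have {}entT (W : {set V}) : W != set0 -> r \notin W -> 0 < #|entering T W|.
  by move=> nW rW; have := forallP entT W; rewrite nW rW.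
suff domT : dom T = setT.
  exists T; split=> //.
  - move=> a b aT bT hab; apply/eqP.
    by have /forall_inP/(_ b bT) := forall_inP injT a aT; rewrite hab eqxx.
  - exact/forall_inP.
  - by move=> v; apply: (forall_inP conT); rewrite domT inE.
apply/eqP; rewrite eqEsubset subsetT /=; apply: contraT => /subsetPn[z _ zT].
have [a [ta ha anew]] : exists a, [/\ tl a \in dom T, hd a \notin dom T &
    forall W : {set V}, W != set0 -> r \notin W -> 0 < #|entering (a |: T) W|].
  (* Adding [a] to [T] takes an arc only from the sets that [a] enters, so these need a second
     one. *)
  have grow a : tl a \in dom T -> hd a \notin dom T ->
      (forall W : {set V}, r \notin W -> hd a \in W -> tl a \notin W -> 1 < #|entering T W|) ->
      forall W : {set V}, W != set0 -> r \notin W -> 0 < #|entering (a |: T) W|.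
    move=> ta ha aent W nW rW.
    have aT : a \notin T by apply: contra ha => aT; rewrite inE imset_f ?orbT.
    have -> : entering (a |: T) W = entering T W :\ a.
      by apply/setP=> c; rewrite !inE negb_or -!andbA.
    have := cardsD1 a (entering T W).
    case: (boolP (a \in entering T W)) => [|_]; last by rewrite add0n => <-; exact: entT.
    by rewrite inE => /and3P[_ haW taW]; have := aent W rW haW taW; lia.
  have out0 (X : {set V}) : X :&: dom T = set0 -> entering T X = entering set0 X.
    move=> X0; apply/setP=> c; rewrite !inE /=; case: (boolP (c \in T)) => //= cT.
    suff /negPf-> : hd c \notin X by [].
    by apply/negP=> hX; have := in_set0 (hd c); rewrite -X0 inE hX inE imset_f ?orbT.
  pose crit (W : {set V}) := [&& r \notin W, W :\: dom T != set0 & #|entering T W| == 1].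
  (* Without critical sets, any arc leaving [dom T] can be added: a set that it enters contains its
     head, outside [dom T], and so is entered twice. *)
  have [W0 critW0|ncrit] := pickP crit; last first.
    pose Z := ~: dom T.
    have nZ : Z != set0 by apply/set0Pn; exists z; rewrite inE.
    have rZ : r \notin Z by rewrite !inE eqxx.
    have /card_gt0P[a] := entT _ nZ rZ; rewrite !inE => /and3P[aT ha ta].
    exists a; split; rewrite ?inE //; first by rewrite negbK in ta.
    apply: grow; rewrite ?inE //; first by rewrite negbK in ta.
    move=> W rW haW taW; have nW : W != set0 by apply/set0Pn; exists (hd a).
    have := ncrit W; rewrite /crit rW /=.
    have -> /= : W :\: dom T != set0 by apply/set0Pn; exists (hd a); rewrite !inE haW andbT.
    by rewrite ltn_neqAle eq_sym => ->; exact: entT.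
  case: (@arg_minnP _ W0 crit (fun X => #|X|) critW0) => W /and3P[rW nWd /eqP W1] Wmin {W0 critW0}.
  have rWd : r \notin W :\: dom T by rewrite inE (negPf rW) andbF.
  (* [W :\: dom T] has lost no arc to [T], so two arcs enter it, whereas one enters [W]: some [a]
     enters it from [W :&: dom T]. *)
  have := ent2 _ nWd rWd; rewrite -out0; last first.
    by rewrite setDE -setIA [_ :&: dom T]setIC setICr setI0.
  move=> Wd2; have [a] : exists a, (a \in entering T (W :\: dom T)) && (a \notin entering T W).
    apply/existsP; apply: contraTT Wd2; rewrite negb_exists -leqNgt -W1 => /forallP sub.
    by apply: subset_leq_card; apply/subsetP=> a aW; have := sub a; rewrite aW negbK.
  rewrite !inE => /andP[/and3P[aT /andP[ha haW] ta]]; rewrite aT haW /= negbK => taW.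
  rewrite taW andbT negbK in ta; exists a; split; rewrite ?inE //.
  apply: grow; rewrite ?inE // => X rX haX taX.
  have hI : hd a \in W :&: X by rewrite inE haW.
  have nI : W :&: X != set0 by apply/set0Pn; exists (hd a).
  have nU : W :|: X != set0 by apply/set0Pn; exists (hd a); rewrite inE haW.
  have rI : r \notin W :&: X by rewrite inE (negPf rW).
  have rU : r \notin W :|: X by rewrite inE (negPf rW) (negPf rX).
  have submod := entering_submod T W X; rewrite W1 in submod.
  (* If only one arc entered [X], submodularity would make [W :&: X] critical, yet it is smaller
     than [W] for lack of [tl a]. *)
  rewrite ltnNge; apply/negP => X1; have /Wmin : crit (W :&: X).
    rewrite /crit rI /=; apply/andP; split; last first.
      by rewrite (tight1 _ _ _ (entT _ nI rI) (entT _ nU rU) submod X1).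
    by apply/set0Pn; exists (hd a); rewrite !inE haW haX !andbT.
  rewrite leqNgt => /negP; apply; apply: proper_card; rewrite properE subsetIl /=.
  by apply/subsetPn; exists (tl a); rewrite // inE (negPf taX) andbF.
have aT : a \notin T by apply: contra ha => aT; rewrite inE imset_f ?orbT.
have subT v : connect (arc_in T) r v -> connect (arc_in (a |: T)) r v.
  apply: connect_sub => u w /exists_inP[c cT cE]; apply: connect1.
  by apply/exists_inP; exists c => //; rewrite inE cT orbT.
have /Tmax : good (a |: T); last by rewrite cardsU1 aT /= ltnn.
apply/and4P; split.
- apply/forall_inP=> b /setU1P[->|bT]; apply/forall_inP=> c /setU1P[->|cT]; apply/implyP => //.
  + by move=> /eqP hac; case/negP: ha; rewrite hac inE imset_f ?orbT.
  + by move=> /eqP hac; case/negP: ha; rewrite -hac inE imset_f ?orbT.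
  + exact/implyP/(forall_inP (forall_inP injT b bT)).
- apply/forall_inP=> b /setU1P[->|/(forall_inP nrT)//].
  by apply: contraNneq ha => ->; rewrite !inE eqxx.
- apply/forall_inP=> v; rewrite /dom imsetU1 setUCA => /setU1P[->|vT]; last first.
    exact/subT/(forall_inP conT).
  apply: connect_trans (subT _ (forall_inP conT _ ta)) (connect1 _).
  by apply/exists_inP; exists a; rewrite ?setU11 ?eqxx.
- by apply/forallP=> W; apply/implyP=> /andP[nW rW]; apply: anew.
Qed.

End Branching.

(** * Pairing the arcs at each vertex *)

Section Transitions.

Variables (V A : finType) (hd tl : A -> V) (e : V -> A) (P : {set A}) (r : V).

Hypothesis hd_e : forall v, hd (e v) = v.
Hypothesis eP : forall v, e v \notin P.
Hypothesis entered : forall W : {set V}, W != set0 -> r \notin W ->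
  exists a, [/\ a \notin P, a != e (hd a), hd a \in W & tl a \notin W].

(* [P] is the set of dummy arcs, and [t a] the arc which follows [a]. *)
Definition transition (t : {perm A}) := [forall a, tl (t a) == hd a].

(** The ways of moving an inconsistency of the colouring from [a] to [b]: if [a] is a dummy or some
    [e v], by toggling the defects at [a] and [b], which share their head; otherwise by recolouring
    [a], which affects only [a] and its predecessor under [t]. *)
Definition step (t : {perm A}) : rel A := fun a b =>
  if a \in P then b == e (hd a)
  else if a == e (hd a) then hd b == hd a else t b == a.

Lemma step_e (t : {perm A}) v b : hd b = v -> step t (e v) b.
Proof. by rewrite /step (negPf (eP v)) hd_e eqxx => ->. Qed.

(* Let W be a minimal reachability class missing e r.  Some f in W leaves a
   vertex x with e x outside W, and f steps to h, the arc paired with it.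
   Exchanging t h and t (e x) makes f step to e x; nothing is lost, because h
   and e x are mutually reachable afterwards. *)
Lemma step_improve (t : {perm A}) a : transition t -> ~~ connect (step t) a (e r) ->
  exists2 t', transition t' &
    #|[set p | connect (step t) p.1 p.2]| < #|[set p | connect (step t') p.1 p.2]|.
Proof.
move=> tr_t a_r; pose reach b := [set c | connect (step t) b c].
case: (@arg_minnP _ a (fun b => ~~ connect (step t) b (e r)) (fun b => #|reach b|) a_r).
move=> {a_r}a a_r amin; set W := reach a in amin.
have WP b : (b \in W) = connect (step t) a b by rewrite inE.
have closedW b c : b \in W -> step t b c -> c \in W.
  by rewrite !WP => ab /connect1; apply: connect_trans.
have reachW b c : b \in W -> c \in W -> connect (step t) b c.
  move=> bW; have sW : reach b \subset W.
    by apply/subsetP=> d; rewrite WP in bW; rewrite WP inE; apply: connect_trans.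
  have/amin leW : ~~ connect (step t) b (e r).
    apply: contra a_r; apply: connect_trans; by rewrite -WP.
  have /eqP <- : reach b == W by rewrite eqEcard sW.
  by rewrite inE.
(* [entered] applies to the set of vertices [v] with [e v] in [W]; if it is empty, [a] itself
   serves. *)
have [f [fW fP fe xW]] : exists f, [/\ f \in W, f \notin P, f != e (hd f) & e (tl f) \notin W].
  pose VW := [set v | e v \in W].
  have [VW0|nVW] := eqVneq VW set0.
    have eW v : e v \notin W by apply/negP => evW; have := in_set0 v; rewrite -VW0 inE evW.
    have aW : a \in W by rewrite WP connect0.
    exists a; split=> //; last by apply: contraTneq aW => ->.
    apply/negP=> aP; have := eW (hd a); rewrite (closedW a) //.
    by rewrite /step aP.
  case: (entered nVW) => [|f [fP fe hfW tfW]]; first by rewrite inE WP.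
  rewrite !inE -!WP in hfW tfW; exists f; split=> //.
  by apply: closedW hfW _; apply: step_e.
pose h := (t^-1)%g f; set x := tl f in xW.
have th : t h = f by rewrite permKV.
have hx : hd h = x by rewrite /x -th (eqP (forallP tr_t h)).
have hW : h \in W by apply: closedW fW _; rewrite /step (negPf fP) (negPf fe) th.
pose t' := (tperm h (e x) * t)%g.
have t'h : t' h = t (e x) by rewrite permM tpermL.
have t'e : t' (e x) = f by rewrite permM tpermR.
have t'D b : b != h -> b != e x -> t' b = t b.
  by move=> bh be; rewrite permM tpermD // eq_sym.
have fex : step t' f (e x) by rewrite /step (negPf fP) (negPf fe) t'e.
(* Within [W] the exchange destroys only the step from [f] to [h], so the old path from [h] survives
   up to its first visit to [f]. *)
have hf : connect (step t') h f.
  have /connectP[p pth lst] := reachW h f hW fW.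
  have t'W b c : b \in W -> b != f -> step t b c -> step t' b c.
    move=> bW bf bc; have cW := closedW _ _ bW bc; move: bc; rewrite /step.
    do 2![case: ifP => // _]; move/eqP=> tc; rewrite t'D ?tc//.
      by apply: contraNneq bf => ch; rewrite -tc ch th.
    by apply: contraNneq xW => <-.
  have pathW b : b \in W -> path (step t) b p -> f = last b p -> connect (step t') b f.
    elim: p b {pth lst} => [b _ _ -> |c p IHp b bW /= /andP[bc cp] lst]; first exact: connect0.
    have [->|bf] := eqVneq b f; first exact: connect0.
    by apply: connect_trans (connect1 (t'W _ _ bW bf bc)) (IHp _ (closedW _ _ bW bc) cp lst).
  exact: pathW.
have hex := connect_trans hf (connect1 fex).
(* The lost steps have detours: from [f] to [h] through [e x], and from [t (e x)] to [e x] through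
   [h] and [f]. *)
have mono b c : connect (step t) b c -> connect (step t') b c.
  apply: connect_sub => {}b {}c bc.
  have [ch|ch] := eqVneq c h.
    move: bc; rewrite {}ch {1}/step; case: ifP => [bP /eqP hb|bP].
      by apply: connect1; rewrite /step bP hb.
    case: ifP => [be /eqP hb|be /eqP tb]; first by apply: connect1; rewrite /step bP be hb.
    by rewrite -tb th; apply: connect_trans (connect1 fex) (connect1 (step_e _ hx)).
  have [ce|ce] := eqVneq c (e x).
    move: bc; rewrite {}ce {1}/step; case: ifP => [bP /eqP hb|bP].
      by apply: connect1; rewrite /step bP hb.
    case: ifP => [be /eqP hb|be /eqP tb]; first by apply: connect1; rewrite /step bP be hb.
    by apply: connect_trans hex; apply: connect1; rewrite /step bP be t'h tb.
  by apply: connect1; move: bc; rewrite /step t'D.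
exists t'.
  apply/forallP=> b; have [->|bh] := eqVneq b h; last have [->|be] := eqVneq b (e x).
  - by rewrite t'h (eqP (forallP tr_t _)) hd_e hx.
  - by rewrite t'e hd_e.
  - by rewrite t'D //; exact: forallP tr_t b.
apply: proper_card; apply/properP; split; first by apply/subsetP=> p; rewrite !inE; apply: mono.
exists (f, e x); rewrite !inE /=; first exact: connect1.
by apply: contra xW => fx; rewrite WP; apply: connect_trans fx; rewrite -WP.
Qed.

(** By balance, the lists of heads and of tails of all arcs have the same multiplicities, so a
    permutation matches them. *)
Lemma exists_transition :
  (forall v, #|[set a | tl a == v]| = #|[set a | hd a == v]|) ->
  exists t, transition t.
Proof.
move=> bal; pose s1 := [tuple hd (enum_val i) | i < #|A|].
pose s2 := [tuple tl (enum_val i) | i < #|A|].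
have cnt (f : A -> V) v : count_mem v [tuple f (enum_val i) | i < #|A|] = #|[set a | f a == v]|.
  rewrite /= count_map -[RHS](card_imset _ enum_rank_inj) -sum1_count big_enum_cond sum1dep_card.
  apply: eq_card => i; rewrite !inE; apply/idP/imsetP => [|[a]]; last first.
    by rewrite inE => fa ->; rewrite enum_rankK.
  by exists (enum_val i); rewrite ?enum_valK // inE.
have /tuple_permP[p pE] : perm_eq s1 s2.
  by apply/allP=> v _; rewrite /= !cnt bal.
have inj : injective (fun a => enum_val (p (enum_rank a))).
  by move=> a b /enum_val_inj/perm_inj/enum_rank_inj.
exists (perm inj); apply/forallP=> a; rewrite permE.
have : tnth s1 (enum_rank a) = tnth [tuple tnth s2 (p i) | i < #|A|] (enum_rank a).
  by congr tnth; apply: val_inj.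
by rewrite !tnth_mktuple enum_rankK => ->.
Qed.

Lemma exists_rooted_transition :
  (forall v, #|[set a | tl a == v]| = #|[set a | hd a == v]|) ->
  exists2 t, transition t & forall a, connect (step t) a (e r).
Proof.
move=> /exists_transition[t0 tr0].
case: (@arg_maxnP _ t0 transition (fun t => #|[set p | connect (step t) p.1 p.2]|) tr0).
move=> t tr_t tmax; exists t => // a; apply: contraT => /(step_improve tr_t)[t' tr_t'].
by rewrite ltnNge => /negP; case; exact: tmax.
Qed.

End Transitions.

(** * Choosing the subgraph *)

Section Colouring.

Variables (V A : finType) (hd : A -> V) (e : V -> A) (P : {set A}) (r : V).
Variable t : {perm A}.

Hypothesis hd_e : forall v, hd (e v) = v.
Hypothesis eP : forall v, e v \notin P.
Hypothesis rooted : forall a, connect (step hd e P t) a (e r).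

(* [s.1] is the colouring and [s.2] the set of defects.  The residue at a, which
   tells that [s] is inconsistent there, can be pushed to [next a] by flipping
   either the colour of a or the defects at a and [next a]; a state minimizing
   the total rank of its residues has none outside e r, hence none at all. *)
Lemma exists_colouring : exists (c : A -> bool) (g : V -> A),
  [/\ forall v, c (e v), forall a, a \in P -> ~~ c a,
      forall a, a != e (hd a) -> a \notin P -> a != g (hd a) -> c (t a) = ~~ c a &
      forall v, ~~ odd (\sum_(a | hd a == v) (c a + c (t a)))].
Proof.
have [next [rk nextP]] := exists_rank rooted.
pose g v := next (e v); pose allowed a := [|| a == e (hd a), a \in P | a == g (hd a)].
pose state := ({ffun A -> bool} * {ffun A -> bool})%type.
pose valid (s : state) := [&& [forall v, s.1 (e v)], [forall a in P, ~~ s.1 a],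
  [forall a, s.2 a ==> allowed a] &
  [forall v, ~~ \big[addb/false]_(a | hd a == v) ~~ s.2 a]].
pose res (s : state) a := ~~ s.2 a (+) s.1 a (+) s.1 (t a).
pose pot s := \sum_a (if (a != e r) && res s a then rk a else 0).
(* Initially just the arcs [e v] are coloured, and [e v] is a defect when the other arcs into [v]
   are even in number; either way the non-defects at [v] are even in number. *)
pose s0 : state := ([ffun a => a == e (hd a)],
  [ffun a => (a == e (hd a)) && ~~ odd #|[set b | hd b == hd a & b != a]|]).
have valid0 : valid s0.
  apply/and4P; split.
  - by apply/forallP=> v; rewrite ffunE hd_e.
  - by apply/forall_inP=> a aP; rewrite ffunE; apply: contraNneq (eP (hd a)) => <-.
  - by apply/forallP=> a; apply/implyP; rewrite ffunE /allowed => /andP[->].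
  apply/forallP=> v; rewrite (bigD1 (e v)) ?hd_e //= ffunE hd_e eqxx /= negbK.
  rewrite (eq_bigr (fun=> odd 1)); last first.
    by move=> a /andP[/eqP <- ae]; rewrite ffunE (negPf ae).
  by rewrite -(big_morph odd oddD (erefl : odd 0 = false)) sum1dep_card addbb.
case: (@arg_minnP _ s0 valid pot valid0) => s vs smin.
have [cE cP dA dP] := and4P vs.
have res0 a : a != e r -> ~~ res s a.
  move=> ar; apply/negP => ra; have [an lt_rk] := nextP a ar.
  have na : next a != a by apply: contraTneq lt_rk => ->; rewrite ltnn.
  suff [s' vs' res'] : exists2 s', valid s' &
      forall b, res s' b = res s b (+) (b == a) (+) (b == next a).
    suff : pot s' < pot s by rewrite ltnNge smin.
    rewrite /pot (bigD1 a) //= [X in _ < X](bigD1 a) //= ar ra res' ra eqxx eq_sym (negPf na) /=.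
    rewrite add0n; apply: leq_ltn_trans (_ : _ <= rk (next a) + \sum_(b | b != a)
       (if (b != e r) && res s b then rk b else 0)) _; last by rewrite ltn_add2r.
    rewrite (bigD1 (next a)) //= [X in _ <= _ + X](bigD1 (next a)) //= addnA leq_add //.
      by case: ifP => _; rewrite ?leq_addr.
    apply: leq_sum => b /andP[ba bn]; by rewrite res' (negPf ba) (negPf bn) !addbF.
  have toggle2 : hd (next a) = hd a -> allowed a -> allowed (next a) ->
      exists2 s', valid s' & forall b, res s' b = res s b (+) (b == a) (+) (b == next a).
    move=> hna aA nA.
    exists (s.1, [ffun b => s.2 b (+) (b == a) (+) (b == next a)]); last first.
      by move=> b; rewrite /res /= ffunE -!addTb -!addbA; do !bool_congr.
    apply/and4P; split=> //=.
      apply/forallP=> b; rewrite ffunE; apply/implyP.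
      case: (eqVneq b a) => [-> //|_]; case: (eqVneq b (next a)) => [-> //|_].
      by rewrite !addbF; apply/implyP; exact: forallP dA b.
    apply/forallP=> v; have := forallP dP v; congr (~~ _).
    under [RHS]eq_bigr do rewrite ffunE -!addTb !addbA.
    rewrite big_split /= big_split /= -addbA.
    have -> : \big[addb/false]_(b | hd b == v) (b == a) (+)
      \big[addb/false]_(b | hd b == v) (b == next a) = false.
      have one z : \big[addb/false]_(b | hd b == v) (b == z) = (hd z == v).
        case: (boolP (hd z == v)) => hz.
          by rewrite (bigD1 z) //= eqxx big1 // => b /andP[_ /negPf].
        by rewrite big1 // => b hb; apply: contraNF hz => /eqP <-.
      by rewrite !one hna addbb.
    by rewrite addbF.
  move: an; rewrite /step; case: ifP => [aP /eqP ne|aP].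
    by apply: toggle2; rewrite /allowed ?ne ?hd_e ?aP ?eqxx ?orbT.
  case: ifP => [ae /eqP hn|ae /eqP tn].
    by apply: toggle2; rewrite /allowed ?ae // /g hn -(eqP ae) eqxx !orbT.
  (* Recolouring [a] changes the residues at [a] and [next a] alone; the prescribed colours survive,
     as [a] is neither a dummy nor some [e v]. *)
  exists ([ffun b => s.1 b (+) (b == a)], s.2); last first.
    move=> b; have -> : (b == next a) = (t b == a) by rewrite -[in RHS]tn (inj_eq perm_inj).
    by rewrite /res /= !ffunE -!addbA; do !bool_congr.
  apply/and4P; split=> //=.
    apply/forallP=> v; rewrite ffunE; have := forallP cE v.
    by case: (eqVneq (e v) a) => [ev|]; rewrite ?addbF // -ev hd_e eqxx in ae *.
  apply/forall_inP=> b bP; rewrite ffunE; have := forall_inP cP b bP.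
  by case: (eqVneq b a) => [ba|]; rewrite ?addbF // -ba bP in aP *.
(* Each colour enters two residues and the non-defects at each vertex are even in number, so the
   residue at [e r] vanishes with all the others. *)
have sum_res : \big[addb/false]_a res s a = false.
  rewrite /res !big_split /= [X in _ (+) X](reindex_inj perm_inj (h := t^-1%g)) /=.
  under [X in _ (+) X]eq_bigr do rewrite permKV.
  rewrite -addbA addbb addbF (partition_big hd predT) //= big1 // => v _.
  by apply/negbTE; exact: forallP dP v.
have {}res0 a : res s a = false.
  have [->|ar] := eqVneq a (e r); last exact/negbTE/res0.
  by rewrite -sum_res (bigD1 (e r)) //= big1 ?addbF // => b br; apply/negbTE/res0.
have cct a : s.1 a (+) s.1 (t a) = ~~ s.2 a.
  by have := res0 a; rewrite /res; case: (s.2 a) (s.1 a) (s.1 (t a)) => [] [] [].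
exists s.1, g; split.
- exact/forallP.
- exact/forall_inP.
- move=> a ae aP ag; have := cct a; case: (boolP (s.2 a)) => [sa|_].
    by have := forallP dA a; rewrite sa /allowed (negPf ae) (negPf aP) (negPf ag).
  by case: (s.1 a) (s.1 (t a)) => [] [].
- move=> v; rewrite (big_morph odd oddD (erefl : odd 0 = false)).
  under eq_bigr do rewrite oddD !oddb cct.
  exact: forallP dP v.
Qed.

End Colouring.

(** Among the arcs into [v], the coloured [e v] contributes 1 or 2 to the sum, a dummy, being
    uncoloured, 0 or 1, [g v] anything from 0 to 2, and every other arc exactly 1. *)
Lemma colouring_degree (V A : finType) (hd : A -> V) (e g : V -> A) (P : {set A}) (t : {perm A})
    (c : A -> bool) v :
  (forall v, c (e v)) -> (forall a, a \in P -> ~~ c a) ->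
  (forall a, a != e (hd a) -> a \notin P -> a != g (hd a) -> c (t a) = ~~ c a) ->
  #|[set a | hd a == v]| <=
      \sum_(a | hd a == v) (c a + c (t a)) + 1 + #|[set a in P | hd a == v]| /\
  \sum_(a | hd a == v) (c a + c (t a)) <= #|[set a | hd a == v]| + 2.
Proof.
move=> ce cP ct; set N := #|[set a | _]|; set D := \sum_(a | _) (c a + _).
have NE : N = \sum_(a | hd a == v) 1 by rewrite sum1dep_card.
have le1 (b : A) : \sum_(a | hd a == v) (a == b) <= 1.
  rewrite big_mkcond (bigD1 b) //= eqxx big1 ?addn0; first by case: ifP.
  by move=> a /negPf ->; rewrite if_same.
have PE : #|[set a in P | hd a == v]| = \sum_(a | hd a == v) (a \in P).
  rewrite cards_sum1 [RHS]big_mkcond /=.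
  by apply: eq_bigr => a _; case: (a \in P); case: (_ == _).
split.
  apply: leq_trans (_ : D + \sum_(a | hd a == v) (a == g v) + \sum_(a | hd a == v) (a \in P) <= _).
    rewrite NE -!big_split /=; apply: leq_sum => a /eqP hv.
    have := ce v; have := ct a; rewrite hv; case: (eqVneq a (e v)) => [->|_ /(_ isT)].
      by move=> _ ->; case: (c _).
    case: (a \in P) => /= [_ _|]; first by rewrite addn1.
    by case: eqP => [|_] /=; [rewrite addn0 addn1 | move=> /(_ isT isT) -> _; case: (c a)].
  by rewrite PE leq_add2r leq_add2l.
apply: leq_trans (_ : N + (\sum_(a | hd a == v) (a == e v) + \sum_(a | hd a == v) (a == g v)) <= _).
  rewrite NE -!big_split /=; apply: leq_sum => a /eqP hv; have := ct a; rewrite hv.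
  case: (boolP (a \in P)) => [/cP/negPf-> _|_]; first by case: (c _); rewrite ?add0n ?leq_addr.
  case: eqP => _; first by case: (c a); case: (c (t a)); case: eqP.
  by case: eqP => _; [case: (c a); case: (c (t a)) | move=> /(_ isT isT isT) ->; case: (c a)].
by rewrite leq_add2l (leq_add (le1 _) (le1 _)).
Qed.

(** * Cuts and degrees in the multigraph *)

Section Cuts.

Variable G : multigraph.
Implicit Types (W : {set vertex G}) (H : {set edge G}).

Let d v := degree [set: edge G] v.

Definition cut W := #|[set a : edge G | ((ends a).1 \in W) != ((ends a).2 \in W)]|.

Lemma cut_submod X Y : cut (X :&: Y) + cut (X :|: Y) <= cut X + cut Y.
Proof.
rewrite /cut !cards_sum1 -!big_split /=; apply: leq_sum => a _; rewrite !inE.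
by do 4!case: (_ \in _).
Qed.

(** Once the edges of the cut are removed, no edge joins [W] to its complement. *)
Lemma cut_edge_connected k W :
  edge_connected G k -> W != set0 -> W != setT -> k <= cut W.
Proof.
move=> hG /set0Pn[u uW] nT; rewrite leqNgt; apply/negP => /hG con.
have /subsetPn[v _ /negP[]] : ~~ ([set: vertex G] \subset W) by rewrite subTset.
rewrite -(closed_connect _ (con u v)) // => x y /exists_inP[a]; rewrite !inE negbK.
by case/eqP=> aW /orP[] /eqP axy; rewrite axy /= in aW.
Qed.

Lemma sum_degree W : \sum_(v in W) d v = 2 * #|inner (@ends G) W| + cut W.
Proof.
rewrite /d /degree /cut /inner !cards_sum1 exchange_big big_distrr -big_split /=.
rewrite big_mkcond /=; apply: eq_bigr => a _; rewrite in_setT.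
have one x : \sum_(v in W) (x == v) = (x \in W).
  case: (boolP (x \in W)) => xW; last first.
    by rewrite big1 // => v vW; apply/eqP; rewrite eqb0; apply: contraNneq xW => ->.
  by rewrite (bigD1 x) //= eqxx big1 // => v /andP[_]; rewrite eq_sym => /negPf->.
by rewrite big_split /= !one; do 2!case: (_ \in _).
Qed.

Lemma sum_half_degree W :
  \sum_(v in W) d v = #|W :&: [set v | odd (d v)]| + 2 * \sum_(v in W) (d v)./2.
Proof.
have -> : #|W :&: [set v | odd (d v)]| = \sum_(v in W) odd (d v).
  rewrite -sum1_card [LHS]big_mkcond [RHS]big_mkcond; apply: eq_bigr => v _.
  by rewrite !inE; case: (v \in W); case: odd.
rewrite big_distrr /= -big_split /=; apply: eq_bigr => v _.
by rewrite -{1}(odd_double_half (d v)) mul2n.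
Qed.

(* The vertices in [B] get one more entering than leaving edge, those in
   [O :\: B] one less. *)
Lemma exists_balanced_orientation r : edge_connected G 4 ->
  exists (o : {set edge G}) (B : {set vertex G}), let O := [set v | odd (d v)] in
    [/\ B \subset O, #|B| = #|O :\: B|,
        forall v, indeg (@ends G) o v = (d v)./2 + (v \in B) &
        forall W, W != set0 -> r \notin W ->
          1 < #|entering (arc_head (@ends G) o) (arc_tail (@ends G) o) set0 W|].
Proof.
move=> hG; pose O := [set v | odd (d v)].
(* The in-degree bounds are doubled to clear the halves of degrees, so a demand of two entering arcs
   becomes 4; 4-edge-connectivity keeps [b] nonnegative. *)
pose b W : int := (Posz (cut W) - 4 * Posz (r \notin W))%R.
have cutT : cut setT = 0.
  by apply/eqP; rewrite cards_eq0; apply/eqP/setP=> a; rewrite !inE.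
have [||||B [sB cB hB]] := @balanced_rounding _ b O.
- move=> X Y _; have := cut_submod X Y; rewrite /b !inE.
  by do 2!case: (r \in _) => /=; clear; lia.
- move=> X nX; rewrite /b; case: (boolP (r \in X)) => rX /=; first by clear; lia.
  have := cut_edge_connected hG nX; have -> : X != setT by apply: contraNneq rX => ->.
  by move/(_ isT); clear; lia.
- by rewrite /b cutT inE.
- move=> X; have := sum_degree X; rewrite sum_half_degree -/O => e.
  exists (Posz (\sum_(v in X) (d v)./2) - Posz #|inner (@ends G) X| - 2 * Posz (r \notin X))%R.
  by rewrite /b; move: e; clear; lia.
pose m v := (d v)./2 + (v \in B).
have sum_m W : \sum_(v in W) m v = \sum_(v in W) (d v)./2 + #|W :&: B|.
  rewrite big_split /=; congr (_ + _); rewrite -sum1_card [LHS]big_mkcond [RHS]big_mkcond.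
  by apply: eq_bigr => v _; rewrite inE; case: (v \in W).
have cO W : #|W :&: O| = #|W :&: B| + #|W :&: (O :\: B)|.
  rewrite -(cardsID B) -setIA (setIidPr sB); congr (_ + _).
  by apply: eq_card => v; rewrite !inE andbCA.
have mW W : #|inner (@ends G) W| + (if (W == set0) || (r \in W) then 0 else 2) <= \sum_(v in W) m v.
  have [->|nW] := eqVneq W set0.
    by rewrite (_ : inner _ set0 = set0) ?cards0 //; apply/setP=> a; rewrite !inE.
  have := hB W nW; have := sum_degree W; rewrite sum_half_degree -/O cO sum_m /b /=.
  by case: (r \in W) => /=; clear; lia.
have mT : \sum_v m v = #|edge G|.
  have := sum_m setT; have := sum_degree setT; rewrite sum_half_degree -/O cO !setTI -cB cutT.
  have -> : inner (@ends G) setT = setT by apply/setP=> a; rewrite !inE.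
  have sT (F : vertex G -> nat) : \sum_(v in [set: vertex G]) F v = \sum_v F v.
    by apply: eq_bigl => v; rewrite inE.
  by rewrite !sT cardsT; clear; lia.
have [|o oP] := @exists_orientation _ _ (@ends G) m mT.
  by move=> W; apply: leq_trans (mW W); rewrite leq_addr.
exists o, B; split=> // W nW rW.
have := mW W; rewrite (negPf nW) (negPf rW) -(eq_bigr _ (fun v _ => oP v)) sum_indeg.
rewrite /entering /inner !cards_sum1; set s1 := \sum_a _; set s2 := \sum_a _; set s3 := \sum_a _.
suff -> : s2 = s1 + s3 by rewrite leq_add2l.
rewrite -big_split /=; apply: eq_bigr => a _; rewrite (head_tail_in _ o) in_set0.
by do 2!case: (_ \in W).
Qed.

Lemma degree_orientation o H v :
  degree H v = \sum_(a in H) ((arc_head (@ends G) o a == v) + (arc_tail (@ends G) o a == v)).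
Proof. by apply: eq_bigr => a _; rewrite /arc_head /arc_tail; case: ifP => // _; rewrite addnC. Qed.

End Cuts.

Theorem theorem1p1 (G : multigraph) (hG : edge_connected G 4) :
  exists H : {set edge G},
    spanning_eulerian H /\
    forall v : vertex G,
      (degree [set: edge G] v)./2 - 1 <= degree H v
        <= uphalf (degree [set: edge G] v) + 2.
Proof.
have [r _|V0] := pickP (fun _ : vertex G => true); last first.
  by exists set0; split=> [|v]; [split=> [u|v]; [have := V0 u | have := V0 v] | have := V0 v].
have [o [B [sB cB degB ent2]]] := exists_balanced_orientation r hG.
set d := degree [set: edge G] in sB cB degB *; set O := [set v | _] in sB cB.
set hd := arc_head _ o in ent2; set tl := arc_tail _ o in ent2.
have [T [injT rT conT entT]] := packed_branching ent2.
(* An arc into [r] is needed as [ev r]. If there is none, [d r] is at most 1, so 4-edge-connectivity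
   leaves no vertex but [r], and the empty edge set serves. *)
have [a0 /eqP a0r|nor] := pickP (fun a => hd a == r); last first.
  have dr : d r <= 1.
    have := degB r; rewrite /indeg (_ : [set a | _] = set0); last first.
      by apply/setP=> a; rewrite !inE nor.
    by rewrite cards0 -{2}(odd_double_half (d r)); case: (_./2) => //; case: odd.
  have Vr : [set r] = setT.
    apply/eqP; apply: contraTT dr => nr; rewrite -ltnNge.
    have n0 : [set r] != set0 by apply/set0Pn; exists r; rewrite inE.
    have := cut_edge_connected hG n0 nr; have := sum_degree [set r]; rewrite big_set1 -/d => ->.
    by clear; lia.
  have Vr1 v : v = r by apply/set1P; rewrite Vr.
  have deg0 v : degree (set0 : {set edge G}) v = 0 by rewrite /degree big_set0.
  exists set0; split=> [|v]; first split=> [u v|v]; rewrite ?deg0 //.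
    by rewrite (Vr1 u) (Vr1 v) connect0.
  by rewrite leq0n andbT (Vr1 v) leq_subLR addn0 (leq_trans (half_leq dr)).
have [ev [hd_ev evT ev_T]] : exists ev : vertex G -> edge G,
    [/\ forall v, hd (ev v) = v, forall v, v != r -> ev v \in T & {in T, forall a, ev (hd a) = a}].
  have ex v : v != r -> exists a, (a \in T) && (hd a == v).
    move=> vr; have /connectP[p] := conT v; case/lastP: p => [_ /= vr'|p w].
      by rewrite vr' eqxx in vr.
    rewrite rcons_path last_rcons => /andP[_ /exists_inP[a aT /andP[_ ha]]] ->.
    by exists a; rewrite aT.
  pose ev v := if v == r then a0 else odflt a0 [pick a in T | hd a == v].
  have evP v : v != r -> (ev v \in T) && (hd (ev v) == v).
    rewrite /ev => vr; rewrite (negPf vr); have [a aP] := ex v vr.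
    by case: pickP => [//|/(_ a)]; rewrite aP.
  exists ev; split=> [v|v /evP/andP[]//|a aT].
    by have [->|/evP/andP[_ /eqP]//] := eqVneq v r; rewrite /ev eqxx.
  by have /andP[evT /eqP hev] := evP _ (rT a aT); apply: injT.
(* The dummies will run from [f1 i] in [B] to [f2 i] in [O :\: B], using each vertex of odd degree
   once. *)
have [f1 f1P] := exists_enumeration (erefl #|B|).
have [f2 f2P] := exists_enumeration (esym cB).
pose A := (edge G + 'I_#|B|)%type.
pose hdA (a : A) := match a with inl b => hd b | inr i => f2 i end.
pose tlA (a : A) := match a with inl b => tl b | inr i => f1 i end.
pose P : {set A} := [set a | if a is inr _ then true else false].
pose eA v : A := inl (ev v).
have hd_eA v : hdA (eA v) = v by rewrite /= hd_ev.
have eAP v : eA v \notin P by rewrite inE.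
have enteredA (W : {set vertex G}) : W != set0 -> r \notin W ->
    exists a, [/\ a \notin P, a != eA (hdA a), hdA a \in W & tlA a \notin W].
  move=> nW rW; have /card_gt0P[a] := entT W nW rW; rewrite inE => /and3P[aT haW taW].
  exists (inl a : A); split=> //; first by rewrite inE.
  apply: contraNneq aT => -[->]; apply: evT; by apply: contraNneq rW => <-.
have cardA (h : A -> vertex G) v :
    #|[set a | h a == v]| = #|[set a | h (inl a) == v]| + #|[set i | h (inr i) == v]|.
  by rewrite !cards_sum1 big_sumType.
have odd_half v := odd_double_half (d v).
have BO v : (v \in B) + (v \in O :\: B) = odd (d v).
  have := subsetP sB v; rewrite !inE.
  by case: (v \in B) => [/(_ isT) ->|_].
have inA v : #|[set a | hdA a == v]| = uphalf (d v).
  by rewrite cardA f2P /= -/(indeg _ o v) degB -addnA BO uphalf_half addnC.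
have outA v : #|[set a | tlA a == v]| = uphalf (d v).
  rewrite cardA f1P /=; have := degree_orientation o setT v; rewrite -/d -/hd -/tl.
  have sT (F : edge G -> nat) : \sum_(a in [set: edge G]) F a = \sum_a F a.
    by apply: eq_bigl => a; rewrite inE.
  rewrite big_split /= !sT -!cards_sum1.
  rewrite -/(indeg _ o v) degB uphalf_half.
  by move: (odd_half v) (BO v); clear; lia.
have [t /forallP tr_t rooted] := exists_rooted_transition hd_eA eAP enteredA
  (fun v => etrans (outA v) (esym (inA v))).
have [c [g [ce cP ct ceven]]] := exists_colouring hd_eA eAP rooted.
pose H := [set a : edge G | c (inl a)].
have sumc (h : A -> vertex G) v :
    \sum_(a | h a == v) (c a : nat) = \sum_(a in H) (h (inl a) == v).
  rewrite big_mkcond big_sumType /= [X in _ + X]big1 ?addn0.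
    rewrite [RHS]big_mkcond /=; apply: eq_bigr => a _; rewrite inE.
    by case: (c _); case: (_ == v).
  by move=> i _; rewrite (negPf (cP (inr i) _)) ?inE // if_same.
(* The arcs out of [v] are the [t a] with [a] into [v], and dummies, being uncoloured, do not
   count. *)
have degH v : degree H v = \sum_(a | hdA a == v) (c a + c (t a)).
  rewrite (degree_orientation o) !big_split /= -(sumc hdA) -(sumc tlA); congr (_ + _).
  by rewrite (reindex_inj (@perm_inj _ t)); apply: eq_bigl => a; rewrite (eqP (tr_t a)).
exists H; split=> [|v]; first split.
- have symH : connect_sym (adjacent H).
    apply: sym_connect_sym => x y; apply: eq_existsb => a; by rewrite orbC.
  have conH v : connect (adjacent H) r v.
    apply: connect_sub (conT v) => x y /exists_inP[a aT /andP[/eqP <- /eqP <-]].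
    apply: connect1; apply/exists_inP; exists a.
      by rewrite inE -(ev_T a aT); exact: ce.
    by rewrite /hd /tl /arc_head /arc_tail; case: ifP; rewrite -surjective_pairing eqxx ?orbT.
  by move=> u v; apply: connect_trans (conH v); rewrite symH.
- by move=> v; rewrite degH.
have [] := colouring_degree v ce cP ct; rewrite -degH inA.
have -> : #|[set a in P | hdA a == v]| = (v \in O :\: B).
  rewrite -f2P !cards_sum1 big_sumType /= big1 ?add0n => [|a _]; last by rewrite inE.
  by apply: eq_bigr => i _; rewrite inE.
(* A dummy enters [v] only when [d v] is odd, and then the rounding up in [uphalf] pays for it. *)
by move: (BO v); rewrite uphalf_half; clear; lia.
Qed.
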